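(* Let $n\ge 0$ be an integer and let $d\in\mathbb{N}$ with $d\equiv 1\pmod 2$. Then \[ C_{n}(d)+C_{n}=2^{2n+1}\sum_{i=0}^{d-1}\binom{\frac{i}{2}}{n}(-1)^{n-i}. \]
   Context: The Catalan numbers $C_n$ are defined by $\frac{2}{1+\sqrt{1-4t}}=\sum_{n\ge0}C_nt^n$, so $C_n=\frac{1}{n+1}\binom{2n}{n}$. The Catalan polynomials $C_n(x)$ are defined by the generating function $\frac{2}{1+\sqrt{1-4t}}(1-4t)^{x/2}=\sum_{n\ge0}C_n(x)t^n$, where $(1-4t)^{a}=\sum_{k\ge0}\binom{a}{k}(-4t)^k$. For any $a$ and integer $k\ge0$, $\binom{a}{k}=\frac{a(a-1)\cdots(a-k+1)}{k!}$. *)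

(* Defs.v *)
(* Formal power series are represented by their coefficient sequences. *)
From HB Require Import structures.
From mathcomp Require Import all_boot all_order all_algebra.

Set Implicit Arguments.
Unset Strict Implicit.
Unset Printing Implicit Defensive.

Import Order.TTheory GRing.Theory Num.Theory.
Local Open Scope ring_scope.

Section PowerSeries.
Variable R : comUnitRingType.
Implicit Types f g : nat -> R.

Definition fps_const (c : R) : nat -> R := fun n => if n is 0 then c else 0.

Definition fps_add f g : nat -> R := fun n => f n + g n.

Definition fps_mul f g : nat -> R :=
  fun n => \sum_(i < n.+1) f i * g (n - i)%N.

(* The first n coefficients of 1 / f, obtained by solving f * g = 1 degree by
   degree. *)
Fixpoint fps_inv_seq f (n : nat) : seq R :=
  if n is m.+1 then
    let s := fps_inv_seq f m in
    rcons s ((fps_const 1 m - \sum_(i < m) s`_i * f (m - i)%N) / f 0%N)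
  else [::].

(* Only meaningful when f 0 is a unit; see fps_mulVf. *)
Definition fps_inv f : nat -> R := fun n => (fps_inv_seq f n.+1)`_n.

Lemma size_fps_inv_seq f n : size (fps_inv_seq f n) = n.
Proof. by elim: n => //= n IHn; rewrite size_rcons IHn. Qed.

Lemma nth_fps_inv_seq f n i : (i < n)%N -> (fps_inv_seq f n)`_i = fps_inv f i.
Proof.
elim: n => // n IHn; rewrite ltnS leq_eqVlt => /predU1P[-> //|lt_in].
by rewrite /= nth_rcons size_fps_inv_seq lt_in IHn.
Qed.

Lemma fps_mulVf f : f 0%N \is a GRing.unit ->
  fps_mul (fps_inv f) f =1 fps_const 1.
Proof.
move=> f0U n; rewrite /fps_mul big_ord_recr /= subnn.
rewrite {2}/fps_inv /= nth_rcons size_fps_inv_seq ltnn eqxx divrK //.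
rewrite addrC -addrA; under eq_bigr do rewrite nth_fps_inv_seq //.
by rewrite addNr addr0.
Qed.

Definition gbinom (a : R) (k : nat) : R :=
  (\prod_(i < k) (a - i%:R)) / k`!%:R.

(* The binomial series (1 - 4t)^a. *)
Definition pow1m4t (a : R) : nat -> R := fun k => gbinom a k * (- 4%:R) ^+ k.

(* 2 / (1 + sqrt (1 - 4t)) *)
Definition catalan_gf : nat -> R :=
  fps_mul (fps_const 2%:R)
          (fps_inv (fps_add (fps_const 1) (pow1m4t 2%:R^-1))).

End PowerSeries.

Definition catalan (n : nat) : rat := catalan_gf rat n.

(* The generating function of the C_n(x) is taken over the coefficient ring
   Q[x], in which 2 and the factorials are units. *)
Definition catalan_poly (n : nat) : {poly rat} :=
  fps_mul (catalan_gf {poly rat}) (pow1m4t (2%:R^-1 *: 'X)) n.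

(* Main.v *)
(* Put s = (1 - 4t)^(1/2). The generating function of C_n(d) + C_n is
   2 (1 + s^d) / (1 + s), which for odd d is the geometric sum of the
   2 (-s)^i for i < d; the coefficient of t^n in s^i is binom(i/2, n) (-4)^n. *)
Require Import Defs.
From HB Require Import structures.
From mathcomp Require Import all_boot all_order all_algebra.
From mathcomp Require Import ring.

Import Order.TTheory GRing.Theory Num.Theory.
Local Open Scope ring_scope.

Section SeriesAlgebra.
Variable R : comUnitRingType.
Implicit Types f g h : nat -> R.

Lemma eq_fps_mul f f' g g' :
  f =1 f' -> g =1 g' -> fps_mul f g =1 fps_mul f' g'.
Proof. by move=> ff' gg' n; apply: eq_bigr => i _; rewrite ff' gg'. Qed.

(* Ring laws for series are inherited from truncated polynomials. *)
Lemma coef_truncM f g N n : (n < N)%N ->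
  ((\poly_(i < N) f i) * (\poly_(i < N) g i))`_n = fps_mul f g n.
Proof.
move=> nN; rewrite coefM; apply: eq_bigr => i _; rewrite !coef_poly.
by rewrite (leq_ltn_trans (leq_subr _ _) nN) (leq_trans (ltn_ord i) nN).
Qed.

Lemma fps_mulC f g : fps_mul f g =1 fps_mul g f.
Proof. by move=> n; rewrite -!(@coef_truncM _ _ n.+1) // mulrC. Qed.

Lemma fps_mulA f g h : fps_mul f (fps_mul g h) =1 fps_mul (fps_mul f g) h.
Proof.
move=> n; pose T u := \poly_(i < n.+1) (u i : R).
have trM u v i : (i < n.+1)%N -> (T u * T v)`_i = fps_mul u v i.
  exact: coef_truncM.
have tr u i : (i < n.+1)%N -> (T u)`_i = u i.
  by move=> lt_in; rewrite coef_poly lt_in.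
(* The inner products may have degree above n; only their coefficients up to n, which agree with
   those of the series product, enter coefficient n. *)
transitivity (T f * (T g * T h))`_n.
  rewrite coefM; apply: eq_bigr => i _.
  by rewrite tr // trM // ltnS leq_subr.
rewrite mulrA coefM; apply: eq_bigr => i _.
by rewrite trM // tr // ltnS leq_subr.
Qed.

Lemma fps_mulDl f g h :
  fps_mul (fps_add f g) h =1 fps_add (fps_mul f h) (fps_mul g h).
Proof.
by move=> n; rewrite /fps_add -big_split; apply: eq_bigr => i _; rewrite mulrDl.
Qed.

Lemma fps_mul_constl (c : R) f n : fps_mul (fps_const c) f n = c * f n.
Proof.
by rewrite /fps_mul big_ord_recl subn0 big1 ?addr0 // => i _; rewrite mul0r.
Qed.

Lemma fps_mul_sumr I (r : seq I) (c : I -> R) (F : I -> nat -> R) f n :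
  fps_mul f (fun k => \sum_(i <- r) c i * F i k) n =
  \sum_(i <- r) c i * fps_mul f (F i) n.
Proof.
rewrite /fps_mul; under eq_bigr do rewrite mulr_sumr.
rewrite exchange_big; apply: eq_bigr => i _; rewrite mulr_sumr.
by apply: eq_bigr => j _; rewrite mulrCA.
Qed.

Lemma eq_fps_inv f g : f =1 g -> fps_inv f =1 fps_inv g.
Proof.
move=> fg n; rewrite /fps_inv; congr (_`_n).
elim: n.+1 => //= m ->; rewrite fg.
by under eq_bigr do rewrite fg.
Qed.

Lemma coef0_pow1m4t (a : R) : pow1m4t a 0 = 1.
Proof. by rewrite /pow1m4t /gbinom big_ord0 expr0 divr1 mulr1. Qed.

End SeriesAlgebra.

Section SeriesMorphism.
Variables (R S : comUnitRingType) (phi : {rmorphism R -> S}).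
Implicit Types f g : nat -> R.

Lemma rmorph_fps_const (c : R) n : phi (fps_const c n) = fps_const (phi c) n.
Proof. by case: n => //= n; rewrite rmorph0. Qed.

Lemma rmorph_fps_mul f g n :
  phi (fps_mul f g n) = fps_mul (phi \o f) (phi \o g) n.
Proof. by rewrite rmorph_sum; apply: eq_bigr => i _; rewrite rmorphM. Qed.

(** Each coefficient of an inverse depends on all earlier ones, so the induction runs on the whole
    list; [phi] commutes with division by [f 0] because it is a unit. *)
Lemma rmorph_fps_inv f n : f 0%N \is a GRing.unit ->
  phi (fps_inv f n) = fps_inv (phi \o f) n.
Proof.
move=> f0U; rewrite /fps_inv.
suff <- : map phi (fps_inv_seq f n.+1) = fps_inv_seq (phi \o f) n.+1.
  by rewrite (nth_map 0) // size_fps_inv_seq.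
elim: n.+1 => //= m IHm; rewrite map_rcons IHm rmorphM rmorphV //.
rewrite rmorphB rmorph_sum rmorph_fps_const rmorph1.
congr (rcons _ ((_ - _) / _)); apply: eq_bigr => i _.
by rewrite rmorphM -IHm (nth_map 0) ?size_fps_inv_seq.
Qed.

Lemma rmorph_pow1m4t (a : R) n : n`!%:R \is a @GRing.unit R ->
  phi (pow1m4t a n) = pow1m4t (phi a) n.
Proof.
move=> nU; rewrite /pow1m4t /gbinom !rmorphM rmorphV // rmorph_nat.
rewrite rmorphXn rmorphN rmorph_nat rmorph_prod.
by under eq_bigr do rewrite rmorphB rmorph_nat.
Qed.

Hypothesis natU : forall n, n.+1%:R \is a @GRing.unit R.

Lemma factU n : n`!%:R \is a @GRing.unit R.
Proof. by rewrite -(prednK (fact_gt0 n)) natU. Qed.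

(** Invertible positive integers, rather than a field, are assumed because the case of use is
    evaluation from Q[x] to Q. *)
Lemma rmorph_catalan_gf n : phi (catalan_gf R n) = catalan_gf S n.
Proof.
rewrite /catalan_gf !fps_mul_constl rmorphM rmorph_nat rmorph_fps_inv.
  congr (_ * _); apply: eq_fps_inv => k /=; rewrite /fps_add rmorphD.
  rewrite rmorph_fps_const rmorph1 rmorph_pow1m4t ?factU //.
  by rewrite rmorphV ?natU // rmorph_nat.
(* The constant term of 1 + s is 1 + 1 = 2. *)
by rewrite /fps_add coef0_pow1m4t (natU 1).
Qed.

End SeriesMorphism.

Section BinomialSeries.
Variable F : numFieldType.
Implicit Types a b : F.

Lemma gbinomS a k : gbinom a k.+1 * k.+1%:R = gbinom a k * (a - k%:R).
Proof.
rewrite /gbinom big_ord_recr /= factS natrM invfM.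
by rewrite mulrAC mulrA mulfK ?pnatr_eq0 // mulrAC.
Qed.

(* Both sides solve (n + 1) c(n + 1) = (a + b - n) c(n). *)
Lemma gbinom_Vandermonde a b n :
  fps_mul (gbinom a) (gbinom b) n = gbinom (a + b) n.
Proof.
elim: n => [|n IHn].
  by rewrite /fps_mul big_ord1 /gbinom !big_ord0 !divr1 mulr1.
have nz : n.+1%:R != 0 :> F by rewrite pnatr_eq0.
apply: (mulIf nz); rewrite gbinomS -IHn /fps_mul !mulr_suml.
(* The factor n + 1 splits as i + (n + 1 - i), one summand for each binomial. *)
transitivity (\sum_(i < n.+2) (gbinom a i * i%:R * gbinom b (n.+1 - i)) +
  \sum_(i < n.+2) (gbinom a i * (gbinom b (n.+1 - i) * (n.+1 - i)%:R))).
  rewrite -big_split; apply: eq_bigr => i _ /=.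
  rewrite natrB; last by rewrite -ltnS.
  ring.
(* The term i = 0 of the first sum and the term i = n + 1 of the second vanish; after a shift, the
   factors a - i and b - (n - i) given by [gbinomS] add up to a + b - n. *)
rewrite big_ord_recl mulr0 mul0r add0r.
rewrite [X in _ + X]big_ord_recr /= subnn !mulr0 addr0 -big_split.
apply: eq_bigr => i _; have le_in : (i <= n)%N by rewrite -ltnS.
rewrite /= /bump add1n subSS subSn // !gbinomS natrB //; ring.
Qed.

(** Vandermonde's identity, with (-4)^n distributed as (-4)^i (-4)^(n-i). *)
Lemma pow1m4tD a b : fps_mul (pow1m4t a) (pow1m4t b) =1 pow1m4t (a + b).
Proof.
move=> n; rewrite /pow1m4t -gbinom_Vandermonde mulr_suml.
apply: eq_bigr => i _.
have -> : (- 4%:R) ^+ n = (- 4%:R) ^+ i * (- 4%:R) ^+ (n - i) :> F.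
  by rewrite -exprD subnKC // -ltnS.
ring.
Qed.

Lemma pow1m4t0 : pow1m4t (0 : F) =1 fps_const 1.
Proof.
case=> [|n]; first exact: coef0_pow1m4t.
by rewrite /pow1m4t /gbinom big_ord_recl subr0 !mul0r.
Qed.

(** With s = (1 - 4t)^a, the product of 1 + s and the sum of the (-s)^i telescopes; by [pow1m4tD],
    the series (1 - 4t)^(ia) can stand for s^i. *)
Lemma geometric_pow1m4t a d n :
  fps_mul (fps_add (fps_const 1) (pow1m4t a))
    (fun k => \sum_(0 <= i < d) (-1) ^+ i * pow1m4t (i%:R * a) k) n =
  fps_const 1 n - (-1) ^+ d * pow1m4t (d%:R * a) n.
Proof.
rewrite fps_mul_sumr; elim: d => [|d IHd].
  by rewrite big_nil mul0r pow1m4t0 mul1r subrr.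
rewrite big_nat_recr //= IHd fps_mulDl /fps_add fps_mul_constl pow1m4tD.
have -> : a + d%:R * a = d.+1%:R * a by rewrite -natr1; ring.
rewrite exprS; ring.
Qed.

Lemma catalan_gf_mul_odd d n : odd d ->
  fps_mul (catalan_gf F) (pow1m4t (d%:R / 2%:R)) n + catalan_gf F n =
  2%:R * \sum_(0 <= i < d) (-1) ^+ i * pow1m4t (i%:R / 2%:R) n.
Proof.
move=> odd_d; pose u := fps_add (fps_const 1) (pow1m4t (2%:R^-1 : F)).
pose B k := \sum_(0 <= i < d) (-1) ^+ i * pow1m4t (i%:R / 2%:R : F) k.
have u0 : u 0%N \is a GRing.unit.
  by rewrite unitfE /u /fps_add coef0_pow1m4t (pnatr_eq0 F 2).
have uB : fps_mul u B =1 fps_add (pow1m4t (d%:R / 2%:R)) (fps_const 1).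
  (* Oddness of d turns 1 - (-1)^d s^d into 1 + s^d. *)
  move=> k; rewrite geometric_pow1m4t -signr_odd odd_d /fps_add; ring.
(* Inserting the series 1 in the second summand lets the generating function factor out, giving 2 (1
   + s)^-1 (s^d + 1). *)
rewrite -[X in _ + X]mul1r -fps_mul_constl.
rewrite [X in X + _]fps_mulC -[LHS]fps_mulDl fps_mulC.
rewrite -(fps_mulA _ _ _ _ n) fps_mul_constl; congr (_ * _).
(* Now s^d + 1 becomes (1 + s) [B], and 1 + s cancels. *)
rewrite -(eq_fps_mul _ _ _ _ _ (frefl _) uB) fps_mulA.
by rewrite (eq_fps_mul _ _ _ _ _ (fps_mulVf u0) (frefl B)) fps_mul_constl mul1r.
Qed.

End BinomialSeries.

(** Evaluation at [x] is a ring morphism, so it passes through the generating function and sends the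
    exponent X/2 to x/2. *)
Lemma horner_catalan_poly n (x : rat) :
  (catalan_poly n).[x] = fps_mul (catalan_gf rat) (pow1m4t (x / 2%:R)) n.
Proof.
have natU k : k.+1%:R \is a @GRing.unit {poly rat}.
  by rewrite -polyC_natr poly_unitE size_polyC coefC pnatr_eq0 unitfE pnatr_eq0.
rewrite -[LHS]/(horner_eval x (catalan_poly n)) rmorph_fps_mul.
apply: eq_fps_mul => k /=; first exact: rmorph_catalan_gf.
rewrite rmorph_pow1m4t ?factU //; congr (pow1m4t _ k).
by rewrite /= /horner_eval hornerZ hornerX mulrC.
Qed.

Theorem theorem1 (n d : nat) (hd : d = 1 %[mod 2]) :
  (catalan_poly n).[d%:R] + catalan n =
  2%:R ^+ (2 * n + 1) *
    \sum_(i < d) gbinom ((i : nat)%:R / 2%:R) n * (-1) ^ (n%:Z - (i : nat)%:Z).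
Proof.
have odd_d : odd d by move: hd; rewrite !modn2; case: odd.
rewrite horner_catalan_poly catalan_gf_mul_odd // big_mkord.
rewrite exprD expr1 [X in _ = X * _]mulrC -mulrA [X in _ = _ * X]mulr_sumr; congr (_ * _).
(* The exponent n - i may be negative; (-1)^(-i) = (-1)^i brings the sign to the form in
   [catalan_gf_mul_odd]. *)
apply: eq_bigr => i _; rewrite expfzDr ?oppr_eq0 ?oner_eq0 //.
rewrite -exprnP -exprnN invr_sign exprM /pow1m4t.
(* Then (-4)^n = 2^(2n) (-1)^n accounts for the power of 2 left after one factor 2 is cancelled. *)
have -> : (- 4%:R : rat) = 2%:R ^+ 2 * -1 by [].
rewrite exprMn; ring.
Qed.
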